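(* Let $p$ be an odd prime, $q=p^f$ with $f\geq 1$, and let $G=G(q)$ be the pro-$p$ group of infinite upper unitriangular matrices over $\mathbb{F}_q$. The following hold. (1) The subgroup $\sigma(\mathcal{N})$ of $G$ isomorphic to the Nottingham group $\mathcal{N}=\mathcal{N}_q$ has Hausdorff dimension $0$. (2) If $q=p$, the subgroup $\varphi(F)\cong C_p*C_p$ of $G$ has Hausdorff dimension $0$. (3) If $H$ is a $d$-periodic subgroup of $G$ for some positive integer $d$, then $\dim(H)=0$. (4) If $H$ is a string subgroup of $G$ of the form $H\leq\prod_{1<n_i\leq N}G_{n_i}$ for some integer $N\geq 2$, then $H$ has Hausdorff dimension $0$.
   Context: $\mathbb{N}$ denotes the positive integers. For $n\in\mathbb{N}$, $G_n=G_n(q)$ is the group of $n\times n$ upper triangular matrices over $\mathbb{F}_q$ with all diagonal entries $1$, and $G=\varprojlim_n G_n$ (inverse limit along the maps deleting the last row and column), with its profinite topology; its elements are the matrices $(x_{ij})_{i,j\in\mathbb{N}}$ over $\mathbb{F}_q$ with $x_{ii}=1$ and $x_{ij}=0$ for $i>j$. $N_n$ is the kernel of $G\to G_n$; $e_{ij}$ is the elementary matrix with a single entry $1$ in position $(i,j)$. Hausdorff dimension is taken with respect to the filtration $(N_n)$: for a closed subgroup $H$, $\dim(H)=\lim_{n\to\infty}\frac{\log|HN_n/N_n|}{\log|G_n|}$ whenever the limit exists. In general, for $M\subseteq G$ and Haar probability measure $m$ on $G$, $\dim(M)$ is the critical exponent $\Delta$ such that $l^\gamma(M)=\infty$ for $\gamma<\Delta$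 and $l^\gamma(M)=0$ for $\gamma>\Delta$, where $l^\gamma(M)=\lim_{\theta\to0}\inf_{\mathcal C}\sum_{B\in\mathcal C}m(B)^\gamma$ and $\mathcal C$ runs over covers of $M$ by cosets $B$ of the subgroups $N_n$, $n\in\mathbb{N}$, with $m(B)<\theta$. (1) The Nottingham group $\mathcal{N}_q$ is the group of $\mathbb{F}_q$-algebra automorphisms of $\mathbb{F}_q[[t]]$ of the form $t\mapsto t+\sum_{j\geq 2}a_jt^j$, acting on the right; $\sigma:\mathcal{N}_q\to G$ sends $u$ to the matrix whose $(i,j)$ entry is the coefficient of $t^j$ in $(t^i)u=(tu)^i$; it is an injective homomorphism. (2) $F=\langle x\rangle*\langle y\rangle$ is the free product of two groups of order $p$ and $\varphi:F\to G(p)$ is the (injective) homomorphism with $\varphi(x)=1+\sum_{n\in\mathbb{N}}e_{2n-1,2n}$, $\varphi(y)=1+\sum_{n\in\mathbb{N}}e_{2n,2n+1}$. (3) For $x\in G$, $x[d]$ is the matrix obtained by deleting the first $d$ rows and columns. A subgroup $H\leq G$ is $d$-periodic if $x=x[d]$ for every $x\in H$. (4) A string is a matrix in $G$ lying in the image of an injective homomorphism $\prod_{n_i>1}G_{n_i}\hookrightarrow G$ placing the factors as pairwise commuting diagonal blocks of size greater than $1$. A string subgroup is a subgroup of $G$ formed by strings; $H\leq\prod_{1<n_i\leq N}G_{n_i}$ means that $H$ is contained in such a block diagonal subgroup whose block sizes $n_i$ all satisfy $1<n_i\leq N$. *)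

(* Defs.v *)
From HB Require Import structures.
From mathcomp Require Import all_boot all_order all_algebra all_fingroup.
From mathcomp Require Import all_classical all_reals all_analysis.

Set Implicit Arguments.
Unset Strict Implicit.
Unset Printing Implicit Defensive.

Import Order.TTheory GRing.Theory Num.Theory.
Import numFieldNormedType.Exports.

Local Open Scope classical_set_scope.
Local Open Scope ring_scope.

(* Rows and columns are indexed from 0: entry (i, j) below is the entry        *)
(* (i + 1, j + 1) of the usual 1-based convention.                             *)

Record unitri (F : finFieldType) := Unitri {
  entry :> nat -> nat -> F ;
  unitriP : forall i j, (j <= i)%N -> entry i j = (i == j)%:R }.

HB.instance Definition _ (F : finFieldType) := gen_eqMixin (unitri F).
HB.instance Definition _ (F : finFieldType) := gen_choiceMixin (unitri F).

Section UnitriGroup.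
Variable F : finFieldType.
Implicit Types x y z : unitri F.

Lemma unitri_ext x y : (forall i j, x i j = y i j) -> x = y.
Proof.
case: x y => [x Px] [y Py] /= exy.
have E : x = y by apply/funext => i; apply/funext => j.
by subst y; congr Unitri; exact: Prop_irrelevance.
Qed.

Fact unitri1_subproof i j : (j <= i)%N -> (i == j)%:R = (i == j)%:R :> F.
Proof. by []. Qed.

Definition unitri1 := Unitri unitri1_subproof.

Definition unitri_mul_entry x y i j : F := \sum_(k < j.+1) x i k * y k j.

Fact unitri_mul_subproof x y i j :
  (j <= i)%N -> unitri_mul_entry x y i j = (i == j)%:R.
Proof.
move=> ji; rewrite /unitri_mul_entry big_ord_recr /= big1 => [|k _].
  by rewrite add0r (unitriP x) // (unitriP y) // eqxx mulr1.
have ki : (k < i)%N by apply: leq_trans ji.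
by rewrite (unitriP x) ?(ltnW ki) // gtn_eqF // mul0r.
Qed.

(* The sum over all k reduces to k <= j because y k j = 0 for k > j. *)
Definition unitri_mul x y := Unitri (@unitri_mul_subproof x y).

Lemma unitri_mulE n x y i j : (j < n)%N ->
  unitri_mul x y i j = \sum_(k < n) x i k * y k j.
Proof.
move=> jn; rewrite /= /unitri_mul_entry.
rewrite (big_ord_widen n (fun k => x i k * y k j) jn) big_mkcond /=.
apply: eq_bigr => k _; case: ifPn => //; rewrite -leqNgt => jk.
by rewrite (unitriP y) ?(ltnW jk) // gtn_eqF // mulr0.
Qed.

(* The inverse solves y x = 1 along each row. *)
Fixpoint unitri_inv_row x i n : seq F :=
  if n is m.+1 then
    let s := unitri_inv_row x i m in
    rcons s ((i == m)%:R - \sum_(k < m) s`_k * x k m)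
  else [::].

Definition unitri_inv_entry x i j : F := (unitri_inv_row x i j.+1)`_j.

Lemma size_unitri_inv_row x i n : size (unitri_inv_row x i n) = n.
Proof. by elim: n => //= n IH; rewrite size_rcons IH. Qed.

Lemma nth_unitri_inv_row x i n j : (j < n)%N ->
  (unitri_inv_row x i n)`_j = unitri_inv_entry x i j.
Proof.
elim: n => // n IH; rewrite ltnS leq_eqVlt => /orP[/eqP -> //|jn].
by rewrite /= nth_rcons size_unitri_inv_row jn IH.
Qed.

Lemma unitri_inv_entryE x i j : unitri_inv_entry x i j =
  (i == j)%:R - \sum_(k < j) unitri_inv_entry x i k * x k j.
Proof.
rewrite {1}/unitri_inv_entry /= nth_rcons size_unitri_inv_row ltnn eqxx.
by congr (_ - _); apply: eq_bigr => k _; rewrite nth_unitri_inv_row.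
Qed.

Fact unitri_inv_subproof x i j :
  (j <= i)%N -> unitri_inv_entry x i j = (i == j)%:R.
Proof.
elim/ltn_ind: j => j IH ji; rewrite unitri_inv_entryE big1 ?subr0 // => k _.
have ki : (k < i)%N by apply: leq_trans ji.
by rewrite IH // ?(ltnW ki) // gtn_eqF // mul0r.
Qed.

Definition unitri_inv x := Unitri (@unitri_inv_subproof x).

Fact unitri_mulA : associative unitri_mul.
Proof.
move=> x y z; apply: unitri_ext => i j /=; rewrite /unitri_mul_entry.
transitivity (\sum_(k < j.+1) \sum_(l < j.+1) x i k * (y k l * z l j)).
  by apply: eq_bigr => k _; rewrite -mulr_sumr.
rewrite exchange_big /=; apply: eq_bigr => l _.
rewrite -/(unitri_mul_entry x y i l) -[unitri_mul_entry _ _ _ _]/(unitri_mul x y i l).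
rewrite (@unitri_mulE j.+1) // mulr_suml.
by apply: eq_bigr => k _; rewrite mulrA.
Qed.

Fact unitri_mul1x : left_id unitri1 unitri_mul.
Proof.
move=> x; apply: unitri_ext => i j.
rewrite (@unitri_mulE (maxn i j).+1) ?ltnS ?leq_maxr //.
have iM : (i < (maxn i j).+1)%N by rewrite ltnS leq_maxl.
rewrite (bigD1 (Ordinal iM)) //= eqxx mul1r big1 ?addr0 // => k ki.
by rewrite (_ : (i == k) = false) ?mul0r //; apply/eqP => ik;
   move/eqP: ki; apply; apply/val_inj.
Qed.

Fact unitri_mulx1 : right_id unitri1 unitri_mul.
Proof.
move=> x; apply: unitri_ext => i j.
rewrite /= /unitri_mul_entry big_ord_recr /= eqxx mulr1 big1 ?add0r // => k _.
by rewrite ltn_eqF // mulr0.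
Qed.

Fact unitri_mulVx : left_inverse unitri1 unitri_inv unitri_mul.
Proof.
move=> x; apply: unitri_ext => i j.
rewrite /= /unitri_mul_entry big_ord_recr /= (unitriP x) // eqxx mulr1.
by rewrite unitri_inv_entryE addrC subrK.
Qed.

Fact unitri_mulxV : right_inverse unitri1 unitri_inv unitri_mul.
Proof.
move=> x; rewrite -[unitri_mul x _]unitri_mul1x.
rewrite -{1}(unitri_mulVx (unitri_inv x)) -unitri_mulA.
by rewrite [unitri_mul (unitri_inv x) _]unitri_mulA unitri_mulVx unitri_mul1x
           unitri_mulVx.
Qed.

HB.instance Definition _ := isGroup.Build (unitri F) unitri_mulA
  unitri_mul1x unitri_mulx1 unitri_mulVx unitri_mulxV.
HB.instance Definition _ := isPointed.Build (unitri F) unitri1.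

End UnitriGroup.

Section Profinite.
Variable F : finFieldType.
Implicit Types (x y : unitri F) (H M U : set (unitri F)).

Definition Gn n : {set 'M[F]_n} :=
  [set A : 'M[F]_n | [forall i : 'I_n, forall j : 'I_n,
              (j <= i)%N ==> (A i j == (i == j)%:R)]]%SET.

Definition truncG n x : 'M[F]_n := \matrix_(i < n, j < n) x i j.

Definition Nn n : set (unitri F) := [set z | truncG n z = 1%:M].

Definition Ncoset n x : set (unitri F) := [set (x * z)%g | z in Nn n].

Lemma truncG_leq m n x : (m <= n)%N -> truncG n x = 1%:M -> truncG m x = 1%:M.
Proof.
move=> mn /matrixP xn; apply/matrixP => i j.
by have := xn (widen_ord mn i) (widen_ord mn j); rewrite !mxE.
Qed.

Definition profinite_open U := forall x, U x -> exists n, Ncoset n x `<=` U.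

Fact profinite_openT : profinite_open setT.
Proof. by move=> x _; exists 0%N. Qed.

Fact profinite_openI U V :
  profinite_open U -> profinite_open V -> profinite_open (U `&` V).
Proof.
move=> oU oV x [/oU[m Um] /oV[n Vn]]; exists (maxn m n) => _ [z zmn <-].
split; [apply: Um | apply: Vn]; exists z => //.
- exact: truncG_leq (leq_maxl m n) zmn.
- exact: truncG_leq (leq_maxr m n) zmn.
Qed.

Fact profinite_open_bigU (I : Type) (f : I -> set (unitri F)) :
  (forall i, profinite_open (f i)) -> profinite_open (\bigcup_i f i).
Proof.
by move=> of_ x [i _ /of_[n sub]]; exists n => y /sub fy; exists i.
Qed.

HB.instance Definition _ := isOpenTopological.Build (unitri F)
  profinite_openT profinite_openI profinite_open_bigU.

Definition subgroup H : Prop :=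
  [/\ H 1%g, forall x y, H x -> H y -> H (x * y)%g
    & forall x, H x -> H (x^-1)%g].

End Profinite.

Section HausdorffDimension.
Variables (R : realType) (F : finFieldType).
Implicit Types (H M : set (unitri F)) (g D : R).

Definition borelG := g_sigma_algebraType (@open (unitri F)).

Definition left_invariant (m : probability borelG R) : Prop :=
  forall (x : unitri F) (A : set borelG), measurable A ->
    m [set (x * a)%g | a in (A : set (unitri F))] = m A.

Variable m : probability borelG R.

Definition coset_cover M (theta : R) : set (set (set (unitri F))) :=
  [set C | [/\ forall B, C B -> exists n x, (0 < n)%N /\ B = Ncoset n x,
              forall B, C B -> (m B < theta%:E)%E
            & M `<=` \bigcup_(B in C) B]].

Definition pre_l_gamma g M (theta : R) : \bar R :=
  ereal_inf [set (\esum_(B in C) poweR (m B) g)%R | C in coset_cover M theta].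

Definition l_gamma g M : \bar R := lim (pre_l_gamma g M theta @[theta --> 0^'+]).

Definition critical_exponent M D : Prop :=
  (forall g, g < D -> l_gamma g M = +oo%E) /\
  (forall g, D < g -> l_gamma g M = 0%E).

(* H N_n / N_n is identified with the image of H in G_n. *)
Definition image_in_Gn H n : {set 'M[F]_n} :=
  [set A : 'M[F]_n | `[< exists2 x, H x & truncG n x = A >]]%SET.

Definition log_density H : R^nat :=
  fun n => ln #|image_in_Gn H n|%:R / ln #|Gn F n|%:R.

(* For a closed subgroup the dimension is in addition required to be given by  *)
(* the limit formula; for other subsets only the general definition applies.   *)
Definition has_Hausdorff_dim M D : Prop :=
  critical_exponent M D /\
  (subgroup M -> closed M -> log_density M n @[n --> \oo] --> D).

End HausdorffDimension.

(* Formal power series; a sequence is wrapped in a record so that it does not  *)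
(* inherit the pointwise product of functions.                                 *)
Record fps (R : Type) := Fps { fps_coef : nat -> R }.

HB.instance Definition _ (R : Type) := gen_eqMixin (fps R).
HB.instance Definition _ (R : Type) := gen_choiceMixin (fps R).

Section PowerSeries.
Variable R : comNzRingType.
Implicit Types a b c : fps R.

Lemma fps_ext a b : (forall n, fps_coef a n = fps_coef b n) -> a = b.
Proof. by case: a b => [a] [b] /= /funext ->. Qed.

Definition fps0 : fps R := Fps (fun=> 0).
Definition fps_add a b := Fps (fun n => fps_coef a n + fps_coef b n).
Definition fps_opp a := Fps (fun n => - fps_coef a n).
Definition fps1 : fps R := Fps (fun n => (n == 0%N)%:R).
Definition fps_mul a b :=
  Fps (fun n => \sum_(i < n.+1) fps_coef a i * fps_coef b (n - i)%N).
Definition fps_scale (r : R) a := Fps (fun n => r * fps_coef a n).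
Definition fps_t : fps R := Fps (fun n => (n == 1%N)%:R).

Fact fps_addA : associative fps_add.
Proof. by move=> a b c; apply: fps_ext => n /=; rewrite addrA. Qed.
Fact fps_addC : commutative fps_add.
Proof. by move=> a b; apply: fps_ext => n /=; rewrite addrC. Qed.
Fact fps_add0 : left_id fps0 fps_add.
Proof. by move=> a; apply: fps_ext => n /=; rewrite add0r. Qed.
Fact fps_addN : left_inverse fps0 fps_opp fps_add.
Proof. by move=> a; apply: fps_ext => n /=; rewrite addNr. Qed.

HB.instance Definition _ := GRing.isZmodule.Build (fps R)
  fps_addA fps_addC fps_add0 fps_addN.

Definition fps_poly N a : {poly R} := \poly_(i < N) fps_coef a i.

Lemma fps_mul_poly N a b n : (n < N)%N ->
  fps_coef (fps_mul a b) n = (fps_poly N a * fps_poly N b)`_n.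
Proof.
move=> nN; rewrite coefM /=; apply: eq_bigr => i _; rewrite !coef_poly.
have iN : (i < N)%N by apply: leq_trans nN; rewrite ltnS -ltnS.
by rewrite iN (leq_ltn_trans (leq_subr i n) nN).
Qed.

Fact fps_mulC : commutative fps_mul.
Proof.
move=> a b; apply: fps_ext => n.
by rewrite !(@fps_mul_poly n.+1) // mulrC.
Qed.

Fact fps_mulA : associative fps_mul.
Proof.
move=> a b c; apply: fps_ext => n; rewrite !(@fps_mul_poly n.+1) //.
transitivity (fps_poly n.+1 a * (fps_poly n.+1 b * fps_poly n.+1 c))`_n.
  rewrite !coefM; apply: eq_bigr => i _; congr (_ * _).
  by rewrite coef_poly ltnS leq_subr (@fps_mul_poly n.+1) // ltnS leq_subr.
rewrite mulrA !coefM; apply: eq_bigr => i _; congr (_ * _).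
by rewrite coef_poly ltn_ord (@fps_mul_poly n.+1).
Qed.

Fact fps_mul1 : left_id fps1 fps_mul.
Proof.
move=> a; apply: fps_ext => n /=.
rewrite big_ord_recl /= mul1r subn0 big1 ?addr0 // => i _.
by rewrite mul0r.
Qed.

Fact fps_mulDl : left_distributive fps_mul +%R.
Proof.
move=> a b c; apply: fps_ext => n /=; rewrite -big_split /=.
by apply: eq_bigr => i _; rewrite mulrDl.
Qed.

Fact fps1_neq0 : fps1 != 0.
Proof.
apply/eqP => /(congr1 (fun a => fps_coef a 0%N)) /= /eqP.
by rewrite oner_eq0.
Qed.

HB.instance Definition _ := GRing.Zmodule_isComNzRing.Build (fps R)
  fps_mulA fps_mulC fps_mul1 fps_mulDl fps1_neq0.

Fact fps_scaleA r s a : fps_scale r (fps_scale s a) = fps_scale (r * s) a.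
Proof. by apply: fps_ext => n /=; rewrite mulrA. Qed.
Fact fps_scale1 : left_id 1 fps_scale.
Proof. by move=> a; apply: fps_ext => n /=; rewrite mul1r. Qed.
Fact fps_scaleDr : right_distributive fps_scale +%R.
Proof. by move=> r a b; apply: fps_ext => n /=; rewrite mulrDr. Qed.
Fact fps_scaleDl a : {morph fps_scale^~ a : r s / r + s}.
Proof. by move=> r s; apply: fps_ext => n /=; rewrite mulrDl. Qed.

HB.instance Definition _ := GRing.Zmodule_isLmodule.Build R (fps R)
  fps_scaleA fps_scale1 fps_scaleDr fps_scaleDl.

Fact fps_scaleAl (r : R) a b : r *: (a * b) = (r *: a) * b.
Proof.
apply: fps_ext => n /=; rewrite mulr_sumr.
by apply: eq_bigr => i _; rewrite mulrA.
Qed.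

HB.instance Definition _ :=
  GRing.Lmodule_isLalgebra.Build R (fps R) fps_scaleAl.

Lemma fps_coef_exp a i j : fps_coef a 0 = 0 -> fps_coef a 1 = 1 ->
  (j <= i)%N -> fps_coef (a ^+ i) j = (i == j)%:R.
Proof.
move=> a0 a1; elim: i j => [|i IH] j ji.
  by rewrite expr0 /= eq_sym.
rewrite exprS /=; case: j ji => [_|j ji].
  by rewrite big_ord1 a0 mul0r.
rewrite big_ord_recl a0 mul0r add0r big_ord_recl /= a1 mul1r subn1 /= IH //.
rewrite big1 ?addr0 // => k _; rewrite /bump /= !add1n subSS IH; last first.
  by rewrite (leq_trans (leq_subr _ _)).
rewrite gtn_eqF ?mulr0 //; apply: leq_trans (ji : (j <= i)%N).
by rewrite ltn_subrL (leq_ltn_trans _ (ltn_ord k)).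
Qed.

End PowerSeries.

Section Nottingham.
Variable F : finFieldType.

Record nottingham := Nottingham {
  nott_aut :> {lrmorphism fps F -> fps F} ;
  nott_bij : bijective nott_aut ;
  nott_t0 : fps_coef (nott_aut (fps_t F)) 0 = 0 ;
  nott_t1 : fps_coef (nott_aut (fps_t F)) 1 = 1 }.

Definition sigma_entry (u : nottingham) i j : F :=
  fps_coef (u (fps_t F ^+ i.+1)) j.+1.

Fact sigma_subproof u i j : (j <= i)%N -> sigma_entry u i j = (i == j)%:R.
Proof.
move=> ji; rewrite /sigma_entry rmorphXn fps_coef_exp //.
- exact: nott_t0.
- exact: nott_t1.
Qed.

Definition sigma (u : nottingham) : unitri F := Unitri (@sigma_subproof u).

End Nottingham.

(* Universal property of the coproduct of two groups. *)
Definition is_free_product (A B P : groupType)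
    (iA : {multiplicative A -> P}) (iB : {multiplicative B -> P}) : Prop :=
  forall (K : groupType) (f : {multiplicative A -> K})
         (g : {multiplicative B -> K}),
  exists h : {multiplicative P -> K},
    [/\ forall a, h (iA a) = f a, forall b, h (iB b) = g b
      & forall h' : {multiplicative P -> K},
          (forall a, h' (iA a) = f a) -> (forall b, h' (iB b) = g b) ->
          forall z, h' z = h z].

Section ParticularElements.
Variable F : finFieldType.

(* Superdiagonal 0/1 matrices; in 0-based indexing e_{2n-1,2n} sits in the     *)
(* rows of even index and e_{2n,2n+1} in those of odd index.                   *)
Definition superdiag_entry (P : pred nat) i j : F :=
  (i == j)%:R + ((j == i.+1) && P i)%:R.

Fact superdiag_subproof P i j :
  (j <= i)%N -> superdiag_entry P i j = (i == j)%:R.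
Proof.
by move=> ji; rewrite /superdiag_entry [j == _]ltn_eqF ?addr0 // ltnS.
Qed.

Definition phi_x : unitri F :=
  Unitri (@superdiag_subproof (fun i => ~~ odd i)).
Definition phi_y : unitri F := Unitri (@superdiag_subproof odd).

End ParticularElements.

Section PeriodicAndStrings.
Variable F : finFieldType.
Implicit Types (x : unitri F) (H : set (unitri F)).

Fact delete_rc_subproof d x i j :
  (j <= i)%N -> x (i + d)%N (j + d)%N = (i == j)%:R.
Proof. by move=> ji; rewrite (unitriP x) ?leq_add2r // eqn_add2r. Qed.

Definition delete_rc d x : unitri F := Unitri (@delete_rc_subproof d x).

Definition d_periodic d H : Prop := forall x, H x -> x = delete_rc d x.

(* A system of pairwise disjoint diagonal blocks of size > 1, indexed by a     *)
(* finite or infinite set I; the i-th block occupies the n i consecutive       *)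
(* positions starting at s i. Positions outside all blocks are allowed: they   *)
(* correspond to the trivial blocks G_1 omitted from the product.              *)
Definition block_system (I : set nat) (s n : nat -> nat) : Prop :=
  (forall i, I i -> (1 < n i)%N) /\
  trivIset I (fun i => [set k | (s i <= k < s i + n i)%N]).

(* Image of the embedding of the product of the G_(n i), i in I. *)
Definition block_image (I : set nat) (s n : nat -> nat) : set (unitri F) :=
  [set x | exists A : forall i, 'M[F]_(n i),
    [/\ forall i, I i -> A i \in Gn F (n i),
        forall i, I i -> forall k l : 'I_(n i),
          x (s i + k)%N (s i + l)%N = A i k l
      & forall k l, ~ (exists2 i, I i &
            (s i <= k < s i + n i)%N && (s i <= l < s i + n i)%N) ->
          x k l = (k == l)%:R]].

Definition is_string x : Prop :=
  exists I s n, block_system I s n /\ block_image I s n x.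

Definition string_subgroup H : Prop :=
  subgroup H /\ (forall x, H x -> is_string x).

Definition in_blocks_le N H : Prop :=
  exists I s n, [/\ block_system I s n, forall i, I i -> (n i <= N)%N
    & H `<=` block_image I s n].

End PeriodicAndStrings.

(* Main.v *)
From HB Require Import structures.
Require Import Defs.
From mathcomp Require Import all_boot all_order all_algebra all_fingroup.
From mathcomp Require Import all_classical all_reals all_analysis.
From mathcomp Require Import zify lra.

(* In each of the four cases the truncation to G_n of an element of H is         *)
(* determined by O(n) of its entries: its first row for the Nottingham group     *)
(* (the coefficients of the image of t), its first d rows for a d-periodic       *)
(* group, a band around the diagonal for bounded blocks. Hence log |H N_n / N_n| *)
(* is linear in n whereas log |G_n| is quadratic, and covering H by cosets of    *)
(* N_n gives dimension 0. Deleting two rows and columns is an endomorphism of G  *)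
(* fixing phi(x) and phi(y), so the universal property makes phi(C_p * C_p)      *)
(* 2-periodic.                                                                   *)

Set Implicit Arguments.
Unset Strict Implicit.
Unset Printing Implicit Defensive.

Import Order.TTheory GRing.Theory Num.Theory.

Local Open Scope classical_set_scope.
Local Open Scope ring_scope.

(** All four cases follow from one criterion, [has_Hausdorff_dim0]: a nonempty [H] whose image in
    G_n has at most q^(c n) elements has dimension 0, whatever the constant c. Since |G_n| is at
    least q^C(n, 2) ([card_Gn_ge]), for each g > 0 the ratio |HN_n/N_n| / |G_n|^g tends to 0
    ([ln_image_small]), which settles the log density. Each coset of N_n has measure 1/|G_n|
    ([haar_NcosetE]), so this ratio is also the cost of covering [H] by such cosets, and [l_gamma]
    vanishes for g > 0. For g < 0 a single small coset already has arbitrarily large cost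
    ([pre_l_gamma_neg]). The growth bounds come from [leq_card_image], coding an element by c n
    entries: [sigma_growth] (c = 1), [periodic_growth] (c = d), [blocks_growth] (c = N). The free
    product falls under the periodic case with d = 2 by [free_product_periodic]. *)

(** * Truncation to G_n and counting *)

Section Truncation.
Variable F : finFieldType.
Implicit Types (x y : unitri F) (H : set (unitri F)).

Lemma truncG_mul n x y : truncG n (x * y)%g = truncG n x *m truncG n y.
Proof.
apply/matrixP => i j; rewrite !mxE (unitri_mulE x y i (ltn_ord j)).
by apply: eq_bigr => k _; rewrite !mxE.
Qed.

Lemma truncG1 n : truncG n (1%g : unitri F) = 1%:M.
Proof. by apply/matrixP => i j; rewrite !mxE. Qed.

Lemma NcosetE n x : Ncoset n x = [set y | truncG n y = truncG n x].
Proof.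
apply/seteqP; split => [_ [z /= zN <-]|y /= yx].
  by rewrite /= truncG_mul zN mulmx1.
exists (x^-1 * y)%g; last by rewrite mulgA mulgV mul1g.
by rewrite /Nn /= truncG_mul yx -truncG_mul mulVg truncG1.
Qed.

Lemma truncG_Gn n x : truncG n x \in Gn F n.
Proof.
rewrite inE; apply/forallP => i; apply/forallP => j; apply/implyP => ji.
by rewrite mxE unitriP.
Qed.

Lemma truncG_surj n (A : 'M[F]_n) :
  A \in Gn F n -> exists x : unitri F, truncG n x = A.
Proof.
rewrite inE => /forallP GA.
(* Pad [A] with the identity outside the n by n corner. *)
pose e i j := if insub i is Some i' then if insub j is Some j' then A i' j'
  else (i == j)%:R else (i == j)%:R.
have eP i j : (j <= i)%N -> e i j = (i == j)%:R.
  move=> ji; rewrite /e; case: insubP => // i' _ ei; case: insubP => // j' _ ej.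
  have /forallP/(_ j') := GA i'; rewrite ei ej ji /= => /eqP ->.
  by rewrite -val_eqE /= ei ej.
exists (Unitri eP); apply/matrixP => i j; rewrite mxE /= /e.
by rewrite !valK.
Qed.

(** The entries above the diagonal are free: functions on increasing pairs of indices, extended by
    0, inject into [Gn F n], and there are C(n, 2) such pairs. *)
Lemma card_Gn_ge n : (#|F| ^ 'C(n, 2) <= #|Gn F n|)%N.
Proof.
pose T := [set t : 2.-tuple 'I_n | sorted ltn [seq val i | i <- t]]%SET.
rewrite -card_ltn_sorted_tuples -/T -(@card_pffun_on _ _ 0 (mem T) (mem F)).
pose M (g : {ffun 2.-tuple 'I_n -> F}) : 'M[F]_n := \matrix_(i, j)
  if (j <= i)%N then (i == j)%:R else g [tuple i; j].
rewrite -(@card_in_imset _ _ M).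
  apply: subset_leq_card; apply/fintype.subsetP => _ /imsetP[g _ ->].
  rewrite inE; apply/forallP => i; apply/forallP => j; apply/implyP => ji.
  by rewrite mxE ji.
move=> g h /pffun_onP[/supportP g0 _] /pffun_onP[/supportP h0 _] /matrixP gh.
apply/ffunP => t; have [tT|tT] := boolP (t \in T); last by rewrite g0 ?h0.
move: tT; case/tupleP: t => i t; case/tupleP: t => j t; rewrite (tuple0 t).
rewrite inE /= andbT => ij; have := gh i j; rewrite !mxE leqNgt ij /=.
by congr (g _ = h _); apply: val_inj.
Qed.

Lemma card_Gn_gt0 n : (0 < #|Gn F n|)%N.
Proof.
apply: leq_trans (card_Gn_ge n).
by rewrite expn_gt0 (ltnW (card_finNzRing_gt1 F)).
Qed.

Definition fiber n (A : 'M[F]_n) : set (unitri F) := [set y | truncG n y = A].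

Lemma fiber_open n (A : 'M[F]_n) : open (fiber A).
Proof. by move=> x xA; exists n; rewrite NcosetE => y /= yx; rewrite /fiber /= yx. Qed.

Lemma leq_card_image (T : finType) H n (code : unitri F -> T) :
  (forall x y, H x -> H y -> code x = code y -> truncG n x = truncG n y) ->
  (#|image_in_Gn H n| <= #|T|)%N.
Proof.
move=> codeP.
have H_of (A : 'M[F]_n) : {x | A \in image_in_Gn H n -> H x /\ truncG n x = A}.
  (* Choose a representative in [H] of each matrix of the image; 1 is a dummy value elsewhere. *)
  apply: cid; have [|_] := boolP (A \in _); last by exists 1%g.
  by rewrite inE => /asboolP[x Hx xA]; exists x.
rewrite -(@card_in_imset _ _ (fun A => code (sval (H_of A)))) ?max_card //.
move=> A B AH BH /=; case: (H_of A) => x /= /(_ AH)[Hx <-].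
by case: (H_of B) => y /= /(_ BH)[Hy <-]; exact: codeP.
Qed.

End Truncation.

(** * Linear growth in the four cases *)

Section Growth.
Variable F : finFieldType.
Implicit Types (x y : unitri F) (H : set (unitri F)).

(** The first row lists the coefficients of t, ..., t^n in the image of t, and these determine the
    coefficients of its powers up to degree n. *)
Lemma sigma_growth n :
  (#|image_in_Gn (range (@sigma F)) n| <= #|F| ^ (1 * n))%N.
Proof.
rewrite -card_mx.
apply: (leq_card_image (code := fun x => \matrix_(i < 1, j < n) x i j)).
move=> _ _ [u _ <-] [v _ <-] /matrixP uv.
set a := u (fps_t F); set b := v (fps_t F).
have ab k : (k <= n)%N -> fps_coef a k = fps_coef b k.
  case: k => [|k kn]; first by rewrite /a /b !nott_t0.
  by have := uv 0 (Ordinal kn); rewrite !mxE /= /sigma_entry !expr1.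
have abX i k : (k <= n)%N -> fps_coef (a ^+ i) k = fps_coef (b ^+ i) k.
  elim: i k => [//|i IH] k kn; rewrite !exprS /=; apply: eq_bigr => l _.
  rewrite IH ?ab ?(leq_trans (leq_subr _ _)) //.
  by apply: leq_trans kn; rewrite -ltnS.
by apply/matrixP => i j; rewrite !mxE /= /sigma_entry !rmorphXn abX.
Qed.

(** Periodicity moves any entry up and left along its diagonal by d, until it reaches the first d
    rows. *)
Lemma periodic_growth H d n : (0 < d)%N -> d_periodic d H ->
  (#|image_in_Gn H n| <= #|F| ^ (d * n))%N.
Proof.
move=> d0 Hd; rewrite -card_mx.
apply: (leq_card_image (code := fun x => \matrix_(i < d, j < n) x i j)).
move=> x y /Hd xd /Hd yd /matrixP xy.
suff E i j : (j < n)%N -> x i j = y i j by apply/matrixP => i j; rewrite !mxE E.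
elim/ltn_ind: i j => i IH j jn; have [id|di] := ltnP i d.
  by have := xy (Ordinal id) (Ordinal jn); rewrite !mxE.
have [ji|ij] := leqP j i; first by rewrite !unitriP.
have dj : (d <= j)%N by apply: leq_trans di (ltnW ij).
have shift (z : unitri F) : z = delete_rc d z -> z i j = z (i - d)%N (j - d)%N.
  by move=> /(congr1 (fun w : unitri F => w (i - d)%N (j - d)%N)) /=; rewrite !subnK.
rewrite (shift x) // (shift y) // IH //; first by rewrite ltn_subrL d0 (leq_trans d0).
by apply: leq_ltn_trans jn; exact: leq_subr.
Qed.

Lemma blocks_growth H N n : in_blocks_le N H ->
  (#|image_in_Gn H n| <= #|F| ^ (N * n))%N.
Proof.
move=> [I [s [b [_ bN HI]]]]; rewrite -card_mx.
apply: (leq_card_image (code := fun x => \matrix_(k < N, i < n) x i (i + k)%N)).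
move=> x y /HI[A [_ _ x0]] /HI[B [_ _ y0]] /matrixP xy.
apply/matrixP => i j; rewrite !mxE.
have [ji|/ltnW ij] := leqP j i; first by rewrite !unitriP.
have [jN|Nj] := ltnP (j - i) N.
  by have := xy (Ordinal jN) i; rewrite !mxE /= subnKC.
(* Two indices at distance at least N cannot share a block, so the entry there is that of the
   identity. *)
have out : ~ (exists2 k, I k &
    (s k <= i < s k + b k)%N && (s k <= j < s k + b k)%N).
  move=> [k /bN kN /andP[/andP[ski _] /andP[_ jk]]].
  have : (j < i + N)%N by apply: (leq_trans jk); rewrite leq_add.
  by rewrite ltnNge -leq_subRL // Nj.
by rewrite x0 // y0.
Qed.

Lemma delete_rcM d : {morph @delete_rc F d : x y / (x * y)%g}.
Proof.
move=> x y; apply: unitri_ext => i j.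
have jn : (j + d < d + j.+1)%N by lia.
rewrite [LHS](unitri_mulE x y (i + d) jn) big_split_ord /=.
(* The terms with index below d lie left of the diagonal of [x], hence vanish; this is why deletion
   respects products. *)
rewrite big1 ?add0r => [|k _]; last first.
  by rewrite (unitriP x) 1?gtn_eqF ?mul0r //; have := ltn_ord k; lia.
rewrite [RHS](unitri_mulE _ _ i (ltnSn j)).
by apply: eq_bigr => k _; rewrite /= [(d + k)%N]addnC.
Qed.

HB.instance Definition _ d :=
  isMultiplicative.Build (unitri F) (unitri F) (delete_rc d) (@delete_rcM d).

Lemma delete_rc2_phi : delete_rc 2 (phi_x F) = phi_x F /\
  delete_rc 2 (phi_y F) = phi_y F.
Proof.
by split; apply: unitri_ext => i j;
   rewrite /= /superdiag_entry /= addn2 addn2 !eqSS /= ?negbK.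
Qed.

Lemma eq_on_cycle (X : finGroupType) (G : groupType)
    (f g : {multiplicative X -> G}) (x z : X) :
  z \in <[x]>%g -> f x = g x -> f z = g z.
Proof.
move=> /cycleP[k ->] fg.
have f1 (h : {multiplicative X -> G}) : h 1%g = 1%g.
  by apply: (mulgI (h 1%g)); rewrite -gmulfM !mulg1.
elim: k => [|k IH]; first by rewrite !expg0 !f1.
by rewrite !expgS !gmulfM IH fg.
Qed.

(** Both [phi] and [delete_rc 2 \o phi] extend the same maps on the two cyclic factors, so
    uniqueness in the universal property identifies them. *)
Lemma free_product_periodic (X Y : finGroupType) (x : X) (y : Y)
    (gen_x : forall z : X, z \in <[x]>%g) (gen_y : forall z : Y, z \in <[y]>%g)
    (P : groupType) (iX : {multiplicative X -> P}) (iY : {multiplicative Y -> P})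
    (phi : {multiplicative P -> unitri F}) :
  is_free_product iX iY -> phi (iX x) = phi_x F -> phi (iY y) = phi_y F ->
  d_periodic 2 (range phi).
Proof.
move=> freeP phix phiy _ [z _ <-]; have [dx dy] := delete_rc2_phi.
have [h [_ _ uniq_h]] := freeP _ (phi \o iX) (phi \o iY).
transitivity (h z); first exact: uniq_h.
symmetry; apply: (uniq_h (@delete_rc F 2 \o phi)) => a.
- by apply: (eq_on_cycle (f := @delete_rc F 2 \o (phi \o iX)) (g := phi \o iX)
    (gen_x a)); rewrite /= phix.
- by apply: (eq_on_cycle (f := @delete_rc F 2 \o (phi \o iY)) (g := phi \o iY)
    (gen_y a)); rewrite /= phiy.
Qed.

End Growth.

(** * Haar measure of the cosets of N_n *)

Lemma fsume_const (R : realType) (I : finType) (A : {set I}) (c : R) :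
  (\sum_(i \in [set` A]) c%:E = (#|A|%:R * c)%:E)%E.
Proof.
rewrite -(@bigfs _ _ _ _ (index_enum I)) ?index_enum_uniq //; last first.
  by move=> i _; rewrite mem_index_enum.
by rewrite sumEFin sumr_const mulr_natl.
Qed.

Section HaarMeasure.
Variables (R : realType) (F : finFieldType).
Variables (m : probability (borelG F) R) (m_haar : left_invariant m).
Implicit Types (x : unitri F) (H M : set (unitri F)).

Lemma Ncoset_measurable n x : measurable (Ncoset n x : set (borelG F)).
Proof. by apply: sub_sigma_algebra; rewrite NcosetE; exact: fiber_open. Qed.

Lemma haar_Ncoset n x : m (Ncoset n x) = m (Ncoset n 1%g).
Proof.
rewrite -(m_haar x (@Ncoset_measurable n 1%g)); congr (m _).
apply/seteqP; split => [_ [z zN <-]|_ [_ [z zN <-] <-]].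
  by exists z => //; exists z; rewrite ?mul1g.
by exists z; rewrite ?mul1g.
Qed.

Lemma haar_fiber n (A : 'M[F]_n) :
  A \in Gn F n -> m (fiber A) = m (Ncoset n 1%g).
Proof. by move=> /truncG_surj[x <-]; rewrite -(haar_Ncoset n x) NcosetE. Qed.

(** The fibers of truncation split G into |G_n| translates of N_n, all of equal measure. *)
Lemma haar_NcosetE n x : m (Ncoset n x) = (#|Gn F n|%:R^-1)%:E.
Proof.
rewrite haar_Ncoset.
have partG : \bigcup_(A in [set` Gn F n]) fiber A = [set: borelG F].
  by apply/seteqP; split => // y _; exists (truncG n y) => //; exact: truncG_Gn.
have /(congr1 m) := partG; rewrite measure_fin_bigcup //; first last.
- by move=> A _; apply: sub_sigma_algebra; exact: fiber_open.
- by move=> A B _ _ [z [<- <-]].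
rewrite probability_setT (eq_fsbigr (fun=> m (Ncoset n 1%g))) => [|A]; last first.
  by rewrite inE => /haar_fiber.
have := fin_num_measure m _ (@Ncoset_measurable n 1%g).
have G0 : #|Gn F n|%:R != 0 :> R by rewrite pnatr_eq0 -lt0n card_Gn_gt0.
move=> /fineK <-; rewrite fsume_const => -[e]; congr EFin.
by apply: (mulfI G0); rewrite e mulfV.
Qed.

End HaarMeasure.

(** * Linear growth implies dimension 0 *)

Section LinearGrowth.
Variables (R : realType) (F : finFieldType) (H : set (unitri F)) (c : nat).
Hypothesis H_neq0 : H !=set0.
Hypothesis H_growth : forall n, (#|image_in_Gn H n| <= #|F| ^ (c * n))%N.

Let lnq : R := ln #|F|%:R.

Lemma lnq_gt0 : 0 < lnq.
Proof. by rewrite ln_gt0 // ltr1n card_finNzRing_gt1. Qed.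

Lemma ln_image_le n : ln #|image_in_Gn H n|%:R <= lnq * (c * n)%:R.
Proof.
rewrite mulr_natr -lnXn ?ltr0n; last exact: ltnW (card_finNzRing_gt1 F).
have [->|h0] := posnP #|image_in_Gn H n|.
  rewrite ln0 // ln_ge0 // -natrX ler1n expn_gt0.
  by rewrite (ltnW (card_finNzRing_gt1 F)).
rewrite ler_ln ?posrE ?ltr0n // -natrX ?ler_nat ?ltr0n //.
exact: leq_trans (H_growth n).
Qed.

Lemma ln_Gn_ge n : lnq * 'C(n, 2)%:R <= ln #|Gn F n|%:R.
Proof.
have q0 : (0 < #|F|)%N by exact: ltnW (card_finNzRing_gt1 F).
rewrite mulr_natr -lnXn ?ltr0n // ler_ln ?posrE -?natrX ?ler_nat ?ltr0n //.
- exact: card_Gn_ge.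
- by rewrite expn_gt0 q0.
- exact: card_Gn_gt0.
Qed.

Lemma bin2_natr n : 'C(n.+1, 2)%:R = n.+1%:R * n%:R / 2 :> R.
Proof.
have : 'C(n.+1, 2)%:R *+ 2 = n.+1%:R * n%:R :> R.
  rewrite -mulrnA -natrM; congr (_%:R).
  by rewrite mulnC mul_bin_left bin1 subn1 mulnC.
lra.
Qed.

Lemma card_image_gt0 n : (0 < #|image_in_Gn H n|)%N.
Proof.
have [x Hx] := H_neq0; apply/card_gt0P; exists (truncG n x).
by rewrite inE; apply/asboolP; exists x.
Qed.

Lemma ln_image_small (g A : R) : 0 < g -> \forall n \near \oo,
  ln #|image_in_Gn H n|%:R - g * ln #|Gn F n|%:R <= A.
Proof.
move=> g0; near=> n.
(* This makes g C(n, 2) at least (c + 1) n, so the difference is at most - n log q; the next bound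
   brings that below [A]. *)
have n1 : 2 * (c%:R + 1) / g + 1 <= n%:R by near: n; exact: nbhs_infty_ger.
have n2 : - A / lnq <= n%:R by near: n; exact: nbhs_infty_ger.
have n3 : (0 < n)%N by near: n; exact: nbhs_infty_gt.
have gn : 2 * (c%:R + 1) <= g * (n%:R - 1).
  by rewrite [g * _]mulrC -ler_pdivrMr // lerBrDr.
have An : - A <= lnq * n%:R by rewrite [lnq * _]mulrC -ler_pdivrMr ?lnq_gt0.
have hH := ln_image_le n; rewrite natrM in hH.
have hG : lnq * (n%:R * (n%:R - 1) / 2) <= ln #|Gn F n|%:R.
  have := ln_Gn_ge n; case: (n) n3 => // k _; rewrite bin2_natr.
  by rewrite -[in k.+1%:R - 1]natr1 addrK.
have := ler_wpM2l (ltW g0) hG.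
have : 0 <= lnq * n%:R * (g * (n%:R - 1) - 2 * (c%:R + 1)).
  by rewrite mulr_ge0 ?subr_ge0 ?mulr_ge0 ?ler0n ?(ltW lnq_gt0).
nra.
Unshelve. all: end_near. Qed.

Lemma log_density_cvg0 : log_density R H n @[n --> \oo] --> 0.
Proof.
apply/cvgr0Pnorm_le => e e0; near=> n.
have small : ln #|image_in_Gn H n|%:R - e * ln #|Gn F n|%:R <= 0 :> R.
  by near: n; exact: ln_image_small.
have lnH : 0 <= ln #|image_in_Gn H n|%:R :> R by rewrite ln_ge0 ?ler1n ?card_image_gt0.
have lnG : 0 <= ln #|Gn F n|%:R :> R by rewrite ln_ge0 ?ler1n ?card_Gn_gt0.
rewrite /log_density ger0_norm ?divr_ge0 //.
(* For n <= 1 the denominator is 0, and so is the quotient by convention. *)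
have [->|G0] := eqVneq (ln #|Gn F n|%:R) (0 : R); first by rewrite invr0 mulr0 ltW.
by rewrite ler_pdivrMr ?lt_neqAle 1?eq_sym ?G0 // -subr_le0.
Unshelve. all: end_near. Qed.

Variables (m : probability (borelG F) R) (m_haar : left_invariant m).

(* Covering by the cosets of a single N_n costs |H N_n / N_n| / |G_n|^g. *)
Lemma pre_l_gamma_pos (g theta : R) : 0 < g -> 0 < theta ->
  pre_l_gamma m g H theta = 0%E.
Proof.
move=> g0 t0.
apply/eqP; rewrite eq_le; apply/andP; split; last first.
  by apply: le_ereal_inf_tmp => _ [C _ <-]; apply: esum_ge0 => B _; exact: poweR_ge0.
apply/lee_addgt0Pr => e e0; rewrite add0e.
have : \forall n \near \oo, [/\ (0 < n)%N, #|Gn F n|%:R^-1 < theta &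
    #|image_in_Gn H n|%:R * (#|Gn F n|%:R^-1 `^ g) <= e].
  near=> n; have G0 : 0 < #|Gn F n|%:R :> R by rewrite ltr0n card_Gn_gt0.
  have I0 : 0 < #|image_in_Gn H n|%:R :> R by rewrite ltr0n card_image_gt0.
  have I1 : 0 <= ln #|image_in_Gn H n|%:R :> R by rewrite ln_ge0 ?ler1n ?card_image_gt0.
  split; first by near: n; exact: nbhs_infty_gt.
    rewrite -ltr_ln ?posrE ?invr_gt0 // lnV ?posrE //.
    (* Exponent 1 suffices here, the image having nonnegative logarithm; the shift by 1 gives
       strictness. *)
    have : ln #|image_in_Gn H n|%:R - 1 * ln #|Gn F n|%:R <= ln theta - 1.
      by near: n; exact: ln_image_small.
    lra.
  rewrite -ler_ln ?posrE ?mulr_gt0 ?powR_gt0 ?invr_gt0 //.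
  rewrite lnM ?posrE ?powR_gt0 ?invr_gt0 // ln_powR lnV ?posrE // mulrN.
  by near: n; exact: ln_image_small.
move=> [n _ /(_ n (leqnn n))[n0 nt ne]].
apply: ge_ereal_inf.
exists (\esum_(B in (@fiber F n) @` [set` image_in_Gn H n]) poweR (m B) g)%R.
  exists ((@fiber F n) @` [set` image_in_Gn H n]) => //.
  have fibE A : A \in image_in_Gn H n -> exists x, fiber A = Ncoset n x.
    by rewrite inE => /asboolP[x _ <-]; exists x; rewrite NcosetE.
  split.
  - by move=> _ [A /fibE[x ->] <-]; exists n, x.
  - by move=> _ [A /fibE[x ->] <-]; rewrite (haar_NcosetE m_haar) lte_fin.
  - move=> x Hx; exists (fiber (truncG n x)) => //; exists (truncG n x) => //=.
    by rewrite inE; apply/asboolP; exists x.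
(* Fibers over the image are nonempty, so distinct matrices have distinct fibers. *)
rewrite esum_image => [|A B]; last first.
  rewrite !inE /= !inE => -[x Hx xA] _ /seteqP[AB _].
  by rewrite -[LHS]xA; exact: AB.
rewrite esum_fset; last 2 first.
- exact: finite_finset.
- by move=> A _; exact: poweR_ge0.
rewrite (eq_fsbigr (fun=> (#|Gn F n|%:R^-1 `^ g)%:E)) => [|A]; last first.
  rewrite !inE /= ?inE => -[x Hx <-].
  by rewrite -[fiber _](NcosetE n x) (haar_NcosetE m_haar) poweR_EFin.
by rewrite fsume_const lee_fin.
Unshelve. all: end_near. Qed.

Lemma pre_l_gamma_neg (g theta : R) : g < 0 -> 0 < theta ->
  ((theta `^ g)%:E <= pre_l_gamma m g H theta)%E.
Proof.
move=> g0 t0; apply: le_ereal_inf_tmp => _ [C [CN Ct HC] <-].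
have [x /HC[B CB _]] := H_neq0.
have mB := Ct _ CB; have [n [y [_ By]]] := CN _ CB.
apply: esum_ge; exists [set B]; first by split; [exact: finite_set1|move=> _ ->].
rewrite fsbig_set1; move: mB; rewrite By (haar_NcosetE m_haar) lte_fin poweR_EFin lee_fin => vt.
have G0 : 0 < #|Gn F n|%:R^-1 :> R by rewrite invr_gt0 ltr0n card_Gn_gt0.
rewrite -ler_ln ?posrE ?powR_gt0 // !ln_powR ler_nM2l // ler_ln ?posrE //.
exact: ltW.
Qed.

Lemma critical_exponent0 : critical_exponent m H 0.
Proof.
split=> g g0.
  apply: cvg_lim => //; apply/cvgeyPge => A.
  (* Replacing [A] by a positive bound allows its power to the exponent 1/g as a threshold for
     [theta]; as g < 0, smaller [theta] gives larger [theta] to the g. *)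
  have A0 : 0 < Num.max A 1 by rewrite lt_max ltr01 orbT.
  near=> theta.
  have t0 : 0 < theta by near: theta; exact: nbhs_right_gt.
  apply: le_trans (pre_l_gamma_neg g0 t0); rewrite lee_fin.
  have tA : theta < Num.max A 1 `^ g^-1.
    by near: theta; apply: nbhs_right_lt; exact: powR_gt0.
  apply: (@le_trans _ _ (Num.max A 1)); first by rewrite le_max lexx.
  move: tA; rewrite -ltr_ln ?posrE ?powR_gt0 // ln_powR => tA.
  rewrite -ler_ln ?posrE ?powR_gt0 // ln_powR.
  by have := ler_wnM2l (ltW g0) (ltW tA); rewrite mulVKf ?lt_eqF.
apply: cvg_lim => //; apply: cvg_near_cst.
by near=> theta; apply: pre_l_gamma_pos => //; near: theta; exact: nbhs_right_gt.
Unshelve. all: end_near. Qed.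

Lemma has_Hausdorff_dim0 : has_Hausdorff_dim m H 0.
Proof. by split=> [|_ _]; [exact: critical_exponent0|exact: log_density_cvg0]. Qed.

End LinearGrowth.

(** * The four cases assembled *)

Definition nottingham1 (F : finFieldType) : nottingham F :=
  @Nottingham F idfun (Bijective (frefl _) (frefl _)) erefl erefl.

Theorem corollary8p7 (R : realType) (p f : nat) (F : finFieldType)
    (p_prime : prime p) (p_odd : odd p) (f_ge1 : (1 <= f)%N)
    (card_F : #|F| = (p ^ f)%N)
    (m : probability (borelG F) R) (m_haar : left_invariant m) :
  [/\ (* (1) *) has_Hausdorff_dim m (range (@sigma F)) 0,
      (* (2) *) (p ^ f)%N = p ->
        forall (X Y : finGroupType) (x : X) (y : Y),
          (forall z : X, z \in <[x]>%g) -> #[x]%g = p ->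
          (forall z : Y, z \in <[y]>%g) -> #[y]%g = p ->
        forall (P : groupType) (iX : {multiplicative X -> P})
               (iY : {multiplicative Y -> P}), is_free_product iX iY ->
        forall phi : {multiplicative P -> unitri F},
          phi (iX x) = phi_x F -> phi (iY y) = phi_y F ->
        has_Hausdorff_dim m (range phi) 0,
      (* (3) *) forall (H : set (unitri F)) (d : nat), subgroup H ->
        (0 < d)%N -> d_periodic d H -> has_Hausdorff_dim m H 0
    & (* (4) *) forall (H : set (unitri F)) (N : nat), string_subgroup H ->
        (2 <= N)%N -> in_blocks_le N H -> has_Hausdorff_dim m H 0].
Proof.
split.
- apply: (has_Hausdorff_dim0 (c := 1) _ _ m_haar) => [|n]; last exact: sigma_growth.
  by exists (sigma (nottingham1 F)), (nottingham1 F).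
- move=> _ X Y x y gen_x _ gen_y _ P iX iY freeP phi phix phiy.
  apply: (has_Hausdorff_dim0 (c := 2) _ _ m_haar) => [|n].
    by exists (phi 1%g), 1%g.
  exact/periodic_growth/(free_product_periodic gen_x gen_y freeP phix phiy).
- move=> H d [H1 _ _] d0 Hd.
  apply: (has_Hausdorff_dim0 (c := d) _ _ m_haar) => [|n]; first by exists 1%g.
  exact: periodic_growth.
- move=> H N [[H1 _ _] _] _ HN.
  apply: (has_Hausdorff_dim0 (c := N) _ _ m_haar) => [|n]; first by exists 1%g.
  exact: blocks_growth.
Qed.
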